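(* Let $p$ be a prime number such that $p \equiv 3 \pmod 4$. Then: (i) if $p \equiv 3 \pmod 8$, then $l(\sqrt{p}) \equiv l(\sqrt{2p}) \equiv 2 \pmod 4$; (ii) if $p \equiv 7 \pmod 8$, then $l(\sqrt{p}) \equiv l(\sqrt{2p}) \equiv 0 \pmod 4$.
   Context: For a real quadratic irrational number $\alpha$, $l(\alpha)$ denotes the minimal period length of its (eventually periodic) usual (regular) continued fraction expansion $a_0+\cfrac{1}{a_1+\cfrac{1}{a_2+\cdots}}$ with $a_0\in\mathbb{Z}$ and $a_i$ positive integers for $i\ge 1$. *)

(* Defs.v *)
From HB Require Import structures.
From mathcomp Require Import all_boot all_order all_algebra.
From mathcomp Require Import all_classical all_reals all_analysis.

Set Implicit Arguments.
Unset Strict Implicit.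
Unset Printing Implicit Defensive.

Import Order.TTheory GRing.Theory Num.Theory.
Import numFieldNormedType.Exports.

Local Open Scope classical_set_scope.
Local Open Scope ring_scope.

(* [a_0; a_1, ..., a_n] = a_0 + 1 / (a_1 + 1 / (... + 1 / a_n)) *)
Fixpoint cf_convergent (R : realType) (a : nat -> int) (n : nat) : R :=
  if n is m.+1 then (a 0%N)%:~R + (cf_convergent R (fun i => a i.+1) m)^-1
  else (a 0%N)%:~R.

(* The value of an infinite continued fraction is the limit of its convergents;
   for an irrational x there is exactly one such sequence a. *)
Definition is_cf_expansion (R : realType) (x : R) (a : nat -> int) : Prop :=
  (forall i : nat, (0 < i)%N -> 0 < a i) /\
  cf_convergent R a n @[n --> \oo] --> x.

Definition eventual_period (T : Type) (a : nat -> T) (l : nat) : Prop :=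
  (0 < l)%N /\
  exists N : nat, forall n : nat, (N <= n)%N -> a (n + l)%N = a n.

Definition is_min_period (T : Type) (a : nat -> T) (l : nat) : Prop :=
  eventual_period a l /\
  forall m : nat, eventual_period a m -> (l <= m)%N.

(* The graph of the function l: cf_period_length x k means l(x) = k.  A relation
   avoids assigning a junk value to the x whose expansion is not periodic. *)
Definition cf_period_length (R : realType) (x : R) (k : nat) : Prop :=
  exists a : nat -> int, is_cf_expansion x a /\ is_min_period a k.

(* Main.v *)
Require Import Defs.
From HB Require Import structures.
From mathcomp Require Import all_boot all_order all_algebra.
From mathcomp Require Import all_classical all_reals all_analysis.
From mathcomp Require Import zify ring lra.

Import Order.TTheory GRing.Theory Num.Theory.
Import numFieldNormedType.Exports.

Local Open Scope ring_scope.

(* For N not a square, the complete quotients (P + sqrt N) / Q that are reduced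
   form a finite set, on which one step of the continued fraction algorithm is
   the composition of two involutions: (P, Q) |-> (a Q - P, Q), with a the
   partial quotient, and (P, Q) |-> (P, (N - P^2) / Q).  Hence the orbit of
   s + sqrt N, s = floor (sqrt N), is periodic, and as its starting point is
   fixed by the first involution the period is symmetric: an odd period has a
   point fixed by the second involution, i.e. N = P^2 + Q^2, and an even period
   2m has at index m a point fixed by the first one, i.e. Q | 2 P, which then
   gives Q | 2 N.  For N = p or 2 p with p = 3 mod 4 the former is impossible and
   the latter forces Q = 2.  Since (-1)^m Q is represented by x^2 - N y^2, the
   residue of N mod 16 decides the parity of m. *)

(** * Recurrence of injective maps and geometric convergence *)

(** By pigeonhole two iterates agree; injectivity cancels the shorter one, so the orbit returns to
    [x] itself. *)
Lemma injective_iter_recurrent {T : eqType} (f : T -> T) (x : T) (r : seq T) :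
  injective f -> (forall n, iter n f x \in r) ->
  exists n, (0 < n)%N && (iter n f x == x).
Proof.
move=> f_inj r_orb; set o := [seq iter i f x | i <- iota 0 (size r).+1].
have : ~~ uniq o.
  apply/negP => /uniq_leq_size o_le; have := o_le r.
  suff /o_le : {subset o <= r} by rewrite size_map size_iota ltnn.
  by move=> _ /mapP[i _ ->].
case/(uniqPn x) => i [j [ij]]; rewrite size_map size_iota => jr.
have ir := ltn_trans ij jr.
rewrite !(nth_map 0%N) ?size_iota // !nth_iota // !add0n => xij.
exists (j - i)%N; rewrite subn_gt0 ij /=; apply/eqP.
have iter_inj k : injective (iter k f) by elim: k => //= k ih a b /f_inj/ih.
by apply: (iter_inj i); rewrite -iterD subnKC // ltnW.
Qed.

Lemma cvg_geometric_bound {R : realType} (u : nat -> R) (x r : R) :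
  0 <= r < 1 -> (forall n, `|u n - x| <= r ^+ n) ->
  (u n @[n --> \oo] --> x)%classic.
Proof.
move=> /andP[r0 r1] u_le.
have r_cvg : (r ^+ n @[n --> \oo] --> (0 : R))%classic.
  by apply: cvg_expr; rewrite ger0_norm.
apply/cvgrPdist_le => e e0.
move/cvgrPdist_le: r_cvg => /(_ e e0); apply: filterS => n.
rewrite sub0r normrN ger0_norm ?exprn_ge0 // => rne.
by rewrite distrC (le_trans (u_le n)).
Qed.

(** * Reduced pairs and the two involutions *)

Section SqrtContinuedFraction.
Variables N s : nat.
Hypotheses (lt_sN : (s ^ 2 < N)%N) (lt_Ns : (N < s.+1 ^ 2)%N).

(* The pair (P, Q) stands for the quadratic irrational (P + sqrt N) / Q; the
   inequalities are the usual sqrt N - P < Q < sqrt N + P, and P <= sqrt N,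
   written with s = floor (sqrt N). *)
Definition reduced (x : nat * nat) : bool :=
  [&& (x.1 <= s)%N, (s < x.1 + x.2)%N, (x.2 <= s + x.1)%N &
      (x.2 %| N - x.1 ^ 2)%N].

(** The integer part of [(P + sqrt N) / Q]: with [P] and [Q > 0] integers, replacing [sqrt N] by its
    floor [s] leaves it unchanged. *)
Definition quot (x : nat * nat) : nat := ((x.1 + s) %/ x.2)%N.

(* Both flips are the identity outside reduced pairs, which makes them
   involutions of the whole type. *)
Definition flipP (x : nat * nat) : nat * nat :=
  if reduced x then ((quot x * x.2 - x.1)%N, x.2) else x.

Definition flipQ (x : nat * nat) : nat * nat :=
  if reduced x then (x.1, ((N - x.1 ^ 2) %/ x.2)%N) else x.

Definition cf_step (x : nat * nat) : nat * nat := flipQ (flipP x).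

Lemma reducedP (P Q : nat) : reduced (P, Q) ->
  exists Q' : nat, [/\ (0 < P <= s)%N, (0 < Q)%N, (s < P + Q)%N,
    (Q <= s + P)%N & (Q * Q' + P ^ 2 = N)%N].
Proof.
case/and4P => /= Ps sPQ Qs /dvdnP[k Nk].
by exists k; split; nia.
Qed.

Lemma reduced_intro (P Q Q' : nat) : (P <= s)%N -> (s < P + Q)%N ->
  (Q <= s + P)%N -> (Q * Q' + P ^ 2 = N)%N -> reduced (P, Q).
Proof.
move=> Ps sPQ Qs NE; rewrite /reduced /= Ps sPQ Qs -NE addnK.
exact: dvdn_mulr.
Qed.

Lemma quotP (P Q : nat) : reduced (P, Q) ->
  [/\ (0 < quot (P, Q))%N, (quot (P, Q) * Q <= P + s)%N,
      (P + s < (quot (P, Q)).+1 * Q)%N & (P <= quot (P, Q) * Q)%N].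
Proof.
case/reducedP => Q' [/andP[P0 Ps] Q0 sPQ Qs _]; rewrite /quot /=.
have a0 : (0 < (P + s) %/ Q)%N by rewrite divn_gt0 // addnC.
have h1 := leq_divM (P + s) Q.
have h2 := ltn_ceil (P + s) Q0.
by split=> //; nia.
Qed.

Lemma flipP_reducedE (P Q : nat) : reduced (P, Q) ->
  flipP (P, Q) = ((quot (P, Q) * Q - P)%N, Q).
Proof. by rewrite /flipP => ->. Qed.

Lemma flipP_reduced (x : nat * nat) : reduced x -> reduced (flipP x).
Proof.
case: x => P Q rx; rewrite flipP_reducedE //.
have [a0 a1 a2 a3] := quotP _ _ rx.
have [Q' [/andP[P0 Ps] Q0 sPQ Qs NE]] := reducedP _ _ rx.
set a := quot _ in a0 a1 a2 a3 *.
(* [k] is the new cofactor [(N - (a Q - P)^2) / Q], expanded with [N = Q Q' + P^2]. *)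
have [k kE] : exists k : nat, (k + a ^ 2 * Q = Q' + 2 * a * P)%N.
  by exists (Q' + 2 * a * P - a ^ 2 * Q)%N; rewrite subnK //; nia.
by apply: (reduced_intro _ _ k); nia.
Qed.

Lemma flipPK : involutive flipP.
Proof.
case=> P Q; have [rx|nrx] := boolP (reduced (P, Q)); last first.
  by rewrite /flipP !(negPf nrx).
have ry := flipP_reduced _ rx.
rewrite flipP_reducedE // in ry *.
have [a0 a1 a2 a3] := quotP _ _ rx.
have [Q' [/andP[P0 Ps] Q0 sPQ Qs NE]] := reducedP _ _ rx.
rewrite flipP_reducedE //; set a := quot (P, Q) in ry a0 a1 a2 a3 *.
suff -> : quot ((a * Q - P)%N, Q) = a by congr (_, _); lia.
rewrite /quot /=; have -> : (a * Q - P + s = a * Q + (s - P))%N by lia.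
by rewrite divnMDl // divn_small ?addn0 //; lia.
Qed.

Lemma flipQ_reducedE (P Q Q' : nat) : reduced (P, Q) ->
  (Q * Q' + P ^ 2 = N)%N -> flipQ (P, Q) = (P, Q').
Proof.
move=> rx NE; rewrite /flipQ rx /= -NE addnK mulKn //.
by have [Q1 []] := reducedP _ _ rx.
Qed.

(** [Q Q' = N - P^2] lies strictly between [s^2 - P^2] and [(s+1)^2 - P^2]; a [Q'] out of bounds
    would push the product past one of these ends. *)
Lemma flipQ_reduced (x : nat * nat) : reduced x -> reduced (flipQ x).
Proof.
case: x => P Q rx.
have [Q' [/andP[P0 Ps] Q0 sPQ Qs NE]] := reducedP _ _ rx.
rewrite (flipQ_reducedE _ _ _ rx NE).
have sPQ' : (s < P + Q')%N.
  rewrite ltnNge; apply/negP => h.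
  have : (Q * Q' <= (s + P) * (s - P))%N by apply: leq_mul => //; lia.
  by rewrite [leqRHS]mulnC -subn_sqr; nia.
have Qs' : (Q' <= s + P)%N.
  rewrite leqNgt; apply/negP => h.
  have : ((s.+1 - P) * (s.+1 + P) <= Q * Q')%N by apply: leq_mul; lia.
  by rewrite -subn_sqr; nia.
by apply: (reduced_intro _ _ Q) => //; rewrite mulnC.
Qed.

Lemma flipQK : involutive flipQ.
Proof.
case=> P Q; have [rx|nrx] := boolP (reduced (P, Q)); last first.
  by rewrite /flipQ !(negPf nrx).
have ry := flipQ_reduced _ rx.
have [Q' [_ _ _ _ NE]] := reducedP _ _ rx.
rewrite (flipQ_reducedE _ _ _ rx NE) in ry *.
by apply: flipQ_reducedE; rewrite // mulnC.
Qed.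

Lemma cf_step_inj : injective cf_step.
Proof. exact: inj_comp (inv_inj flipQK) (inv_inj flipPK). Qed.

Lemma cf_step_reduced (x : nat * nat) : reduced x -> reduced (cf_step x).
Proof. by move=> rx; apply/flipQ_reduced/flipP_reduced. Qed.

(** * The orbit of [s + sqrt N] and its period *)

Definition start : nat * nat := (s, 1%N).

Lemma s_gt0 : (0 < s)%N.
Proof. by case: s lt_sN lt_Ns => // h0 h1; lia. Qed.

Lemma start_reduced : reduced start.
Proof. by apply: (reduced_intro _ _ (N - s ^ 2)); lia. Qed.

Lemma quot_start : quot start = (2 * s)%N.
Proof. by rewrite /quot divn1 mul2n addnn. Qed.

Lemma flipP_start : flipP start = start.
Proof. by rewrite flipP_reducedE ?start_reduced // quot_start; congr (_, _); lia. Qed.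

(** Lets a period of the partial quotients be read as a period of the states:
    [2 s Q <= P + s <= 2 s] forces [Q = 1]. *)
Lemma reduced_quot_startP (x : nat * nat) :
  reduced x -> quot x = (2 * s)%N -> x = start.
Proof.
case: x => P Q rx qx.
have [a0 a1 a2 a3] := quotP _ _ rx.
have [Q' [/andP[P0 Ps] Q0 sPQ Qs NE]] := reducedP _ _ rx.
rewrite qx in a1; have Q1 : Q = 1%N by nia.
by rewrite /start Q1; congr (_, _); lia.
Qed.

Lemma iter_reduced (n : nat) (x : nat * nat) :
  reduced x -> reduced (iter n cf_step x).
Proof. by move=> rx; elim: n => //= n /cf_step_reduced. Qed.

Lemma iter_cf_step_reduced (n : nat) : reduced (iter n cf_step start).
Proof. exact: iter_reduced start_reduced. Qed.

Lemma cf_step_recurrent : exists n, (0 < n)%N && (iter n cf_step start == start).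
Proof.
apply: (injective_iter_recurrent _ _
  [seq (P, Q) | P <- iota 0 s.+1, Q <- iota 0 (2 * s).+1]) cf_step_inj _ => n.
have := iter_cf_step_reduced n; case: (iter _ _ _) => P Q /reducedP[Q' [hP hQ _ hs _]].
by apply/allpairsP; exists (P, Q); rewrite !mem_iota /=; split=> //; lia.
Qed.

Definition cf_period : nat := ex_minn cf_step_recurrent.

Lemma cf_period_gt0 : (0 < cf_period)%N.
Proof. by rewrite /cf_period; case: ex_minnP => n /andP[]. Qed.

Lemma iter_cf_period : iter cf_period cf_step start = start.
Proof. by rewrite /cf_period; case: ex_minnP => n /andP[_ /eqP]. Qed.

Lemma cf_period_le (n : nat) :
  (0 < n)%N -> iter n cf_step start = start -> (cf_period <= n)%N.
Proof.
move=> n0 nE; rewrite /cf_period; case: ex_minnP => m _; apply.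
by rewrite n0 nE eqxx.
Qed.

(** * Symmetry of the period *)

(* flipP conjugates cf_step to its inverse. *)
Lemma iter_cf_step_flipP (n : nat) (x : nat * nat) :
  iter n cf_step (flipP (iter n cf_step x)) = flipP x.
Proof.
have stepP y : cf_step (flipP (cf_step y)) = flipP y.
  by rewrite /cf_step flipPK flipQK.
by elim: n x => // n ih x; rewrite iterSr iterS stepP ih.
Qed.

Lemma cf_period_even_center (m : nat) : cf_period = m.*2 ->
  flipP (iter m cf_step start) = iter m cf_step start.
Proof.
move=> lE; have iter_inj k : injective (iter k cf_step).
  by elim: k => //= k ih a b /cf_step_inj/ih.
apply: (iter_inj m); rewrite iter_cf_step_flipP flipP_start.
by rewrite -iterD addnn -lE iter_cf_period.
Qed.

Lemma cf_period_odd_sum_squares (m : nat) : cf_period = m.*2.+1 ->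
  exists P Q : nat, N = (P ^ 2 + Q ^ 2)%N.
Proof.
move=> lE; have iter_inj k : injective (iter k cf_step).
  by elim: k => //= k ih a b /cf_step_inj/ih.
set y := flipP (iter m cf_step start).
have ry : reduced y by apply/flipP_reduced/iter_cf_step_reduced.
have fy : flipQ y = y.
  (* [flipQ y] is the iterate of index [m + 1], so [m] more steps take it, like [y], to [start]. *)
  apply: (iter_inj m); rewrite {2}/y iter_cf_step_flipP flipP_start.
  by rewrite -[RHS]iter_cf_period lE -addnn -addnS iterD.
case: y ry fy => P Q ry.
have [Q' [_ _ _ _ NE]] := reducedP _ _ ry.
by rewrite (flipQ_reducedE _ _ _ ry NE) => -[QQ]; exists P, Q; lia.
Qed.

(** * Norms represented along the orbit *)

Lemma cf_step_norm (n P Q : nat) : iter n cf_step start = (P, Q) ->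
  exists x y : int, x ^+ 2 - N%:Z * y ^+ 2 = (-1) ^+ n * Q%:Z.
Proof.
(* Up to sign, x / y and u / v are two consecutive convergents; the norms and
   the mixed product evolve together. *)
suff inv : exists x y u v : int,
    [/\ x ^+ 2 - N%:Z * y ^+ 2 = (-1) ^+ n * (iter n cf_step start).2%:Z,
        x * u - N%:Z * (y * v) = - ((-1) ^+ n * (iter n cf_step start).1%:Z) &
        u ^+ 2 - N%:Z * v ^+ 2 =
          - ((-1) ^+ n * (flipQ (iter n cf_step start)).2%:Z)].
  by move=> E; have [x [y [u [v [+ _ _]]]]] := inv; rewrite E; exists x, y.
elim: n P Q => [|n ih] P Q.
  (* The formal convergents [1/0] and [0/1] of [s + sqrt N], each numerator lowered by [s] times its
     denominator. *)
  exists 1, 0, (- s%:Z), 1.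
  rewrite (flipQ_reducedE s 1 (N - s ^ 2) start_reduced) /=; last by lia.
  by split; lia.
have [x [y [u [v]]]] := ih 0%N 0%N.
have := iter_cf_step_reduced n; have := iter_cf_step_reduced n.+1.
rewrite iterS; case: (iter _ _ _) => {}P {}Q.
rewrite /cf_step flipQK => rx' rx.
have := flipP_reduced _ rx; rewrite flipP_reducedE // in rx' * => ry.
have [a0 a1 a2 a3] := quotP _ _ rx.
have [Q' [_ Q0 _ _ NE]] := reducedP _ _ rx.
have [Q'' [_ _ _ _ NE']] := reducedP _ _ ry.
rewrite (flipQ_reducedE _ _ _ rx NE) (flipQ_reducedE _ _ _ ry NE') /=.
move: (quot _) a3 NE' => {a0 a1 a2} a a3 NE'.
have PE : (a * Q - P)%N%:Z = a%:Z * Q%:Z - P%:Z by lia.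
have NZ : Q%:Z * Q'%:Z + P%:Z ^+ 2 = N%:Z by lia.
have NZ' : Q%:Z * Q''%:Z + (a%:Z * Q%:Z - P%:Z) ^+ 2 = N%:Z.
  by rewrite -NE' -PE.
have QE : Q''%:Z = Q'%:Z + 2 * a%:Z * P%:Z - a%:Z ^+ 2 * Q%:Z.
  apply: (@mulfI _ Q%:Z); first by lia.
  apply: (addIr ((a%:Z * Q%:Z - P%:Z) ^+ 2)).
  by rewrite NZ' -NZ; ring.
move=> [E1 E2 E3].
(* The usual recurrence for convergents; the norm is expanded as a polynomial in [a]. *)
exists (a%:Z * x + u), (a%:Z * y + v), x, y; rewrite [(-1) ^+ n.+1]exprS QE PE.
split.
- transitivity (a%:Z ^+ 2 * (x ^+ 2 - N%:Z * y ^+ 2)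
    + 2 * a%:Z * (x * u - N%:Z * (y * v)) + (u ^+ 2 - N%:Z * v ^+ 2)); first ring.
  by rewrite E1 E2 E3; ring.
- transitivity (a%:Z * (x ^+ 2 - N%:Z * y ^+ 2) + (x * u - N%:Z * (y * v))); first ring.
  by rewrite E1 E2; ring.
- by rewrite E1; ring.
Qed.

Lemma cf_period_even_norm (m : nat) : cf_period = m.*2 ->
  exists (P Q : nat) (x y : int),
    [/\ (0 < P <= s)%N, (1 < Q)%N, (Q %| 2 * P)%N, (Q %| N - P ^ 2)%N &
        x ^+ 2 - N%:Z * y ^+ 2 = (-1) ^+ m * Q%:Z].
Proof.
move=> lE; have fixm := cf_period_even_center _ lE.
have := iter_cf_step_reduced m; have := cf_step_norm m.
have : iter m cf_step start <> start.
  by move/cf_period_le => h; have := cf_period_gt0; lia.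
move: fixm; case: (iter _ _ _) => P Q fixm neq /(_ _ _ erefl)[x [y xy]] rx.
have [Q' [hP Q0 sPQ Qs NE]] := reducedP _ _ rx.
have [a0 a1 a2 a3] := quotP _ _ rx.
exists P, Q, x, y; split=> //.
- rewrite ltn_neqAle Q0 andbT; apply/eqP => Q1; apply: neq.
  by rewrite /start -Q1; congr (_, _); lia.
- move: fixm; rewrite flipP_reducedE // => -[fE]; apply/dvdnP.
  by exists (quot (P, Q)); lia.
- by rewrite -NE addnK dvdn_mulr.
Qed.


(** * Partial quotients and their minimal period *)

Lemma iter_cf_period_add (k n : nat) :
  iter (n + k * cf_period) cf_step start = iter n cf_step start.
Proof.
rewrite iterD; congr iter; elim: k => // k ih.
by rewrite mulSn iterD ih iter_cf_period.
Qed.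

(* At index 0 the quotient of (s + sqrt N) / 1 is 2 s, whereas sqrt N itself has
   integer part s. *)
Definition cf_quot (n : nat) : int :=
  if n is 0 then s%:Z else (quot (iter n cf_step start))%:Z.

Lemma cf_quot_min_period : is_min_period cf_quot cf_period.
Proof.
have quotE n : (0 < n)%N -> cf_quot n = (quot (iter n cf_step start))%:Z by case: n.
have l0 := cf_period_gt0; split.
  split=> //; exists 1%N => n n0.
  rewrite !quotE // ?addn_gt0 ?n0 //.
  by rewrite -[in LHS](mul1n cf_period) iter_cf_period_add.
move=> m [m0 [K aK]]; apply: cf_period_le => //.
apply: reduced_quot_startP; first exact: iter_cf_step_reduced.
(* A multiple of the period beyond the preperiod [K]: the state there is [start], so the quotient
   [m] places later is again [2 s]. *)
have nK : (K <= K.+1 * cf_period)%N by nia.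
have := aK _ nK; rewrite !quotE ?addn_gt0 ?muln_gt0 ?l0 //.
have startE : iter (K.+1 * cf_period) cf_step start = start.
  exact: (iter_cf_period_add K.+1 0).
by rewrite addnC iter_cf_period_add startE quot_start => -[].
Qed.

(** * Convergence of the expansion to [sqrt N] *)

Section Value.
Variable R : realType.

Let w : R := Num.sqrt N%:R.

Definition cf_value (x : nat * nat) : R := (x.1%:R + w) / x.2%:R.

Let r : R := (1 + (w - s%:R) / (2 * s%:R))^-1.

Lemma sqr_sqrtN : w ^+ 2 = N%:R.
Proof. by rewrite sqr_sqrtr. Qed.

Lemma sqrtN_gt : s%:R < w.
Proof.
have w0 : 0 <= w by apply: sqrtr_ge0.
by rewrite -(@ltr_pXn2r _ 2) ?nnegrE // sqr_sqrtN -natrX ltr_nat.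
Qed.

Lemma cf_value_step (x : nat * nat) : reduced x ->
  cf_value x = (quot x)%:R + (cf_value (cf_step x))^-1.
Proof.
case: x => P Q rx; have ry := flipP_reduced _ rx.
rewrite /cf_step; rewrite flipP_reducedE // in ry *.
have [a0 a1 a2 a3] := quotP _ _ rx.
have [Q' [/andP[P0 _] Q0 _ _ NE]] := reducedP _ _ rx.
have [Q'' [_ _ _ _ NE']] := reducedP _ _ ry.
rewrite (flipQ_reducedE _ _ _ ry NE') /cf_value /= invf_div.
move: (quot _) a3 NE' => {a0 a1 a2 rx ry} a a3 NE'.
have QR : Q%:R != 0 :> R by rewrite pnatr_eq0 -lt0n.
have W : w ^+ 2 = Q%:R * Q''%:R + (a%:R * Q%:R - P%:R) ^+ 2.
  by rewrite sqr_sqrtN -NE' natrD natrM natrX natrB // natrM.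
have sw := sqrtN_gt.
have D0 : a%:R * Q%:R - P%:R + w != 0.
  rewrite gt_eqF // ltr_wpDl //; last by rewrite (le_lt_trans _ sw).
  by rewrite -natrM subr_ge0 ler_nat.
rewrite natrB // natrM; apply/eqP; rewrite -subr_eq0; apply/eqP.
(* After rationalizing, the difference of the two sides is a multiple of [w^2 - N]. *)
transitivity ((w ^+ 2 - (Q%:R * Q''%:R + (a%:R * Q%:R - P%:R) ^+ 2))
   / (Q%:R * (a%:R * Q%:R - P%:R + w))); last by rewrite W subrr mul0r.
by field; rewrite QR D0.
Qed.

(** As [Q <= s + P <= 2 s], [(P + w) / Q >= 1 + (w - s) / (s + P) >= 1 + (w - s) / (2 s)]. *)
Lemma cf_value_ge (x : nat * nat) : reduced x -> r^-1 <= cf_value x.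
Proof.
case: x => P Q /reducedP[Q' [/andP[P0 Ps] Q0 _ Qs _]].
have sw := sqrtN_gt.
have QR : 0 < Q%:R :> R by rewrite ltr0n.
have PsR : P%:R <= s%:R :> R by rewrite ler_nat.
have QsR : Q%:R <= s%:R + P%:R :> R by rewrite -natrD ler_nat.
have sR : 0 < s%:R :> R by rewrite ltr0n s_gt0.
rewrite invrK /cf_value /= ler_pdivlMr //.
have h : (w - s%:R) / (2 * s%:R) * Q%:R <= w - s%:R.
  rewrite mulrAC ler_pdivrMr; last by lra.
  by apply: ler_wpM2l; lra.
lra.
Qed.

Lemma ratio_bounds : 0 < r < 1.
Proof.
have sw := sqrtN_gt.
have sR : 0 < s%:R :> R by rewrite ltr0n s_gt0.
have d0 : 0 < (w - s%:R) / (2 * s%:R) by apply: divr_gt0; lra.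
by rewrite invr_gt0 invf_lt1; lra.
Qed.

Lemma cf_convergentS (a : nat -> int) (n : nat) :
  cf_convergent R a n.+1 = (a 0%N)%:~R + (cf_convergent R (fun i => a i.+1) n)^-1.
Proof. by []. Qed.

Lemma cf_convergent_ge1 (a : nat -> int) (n : nat) :
  (forall i, 0 < a i) -> 1 <= cf_convergent R a n.
Proof.
elim: n a => [|n ih] a a0.
  by rewrite /= ler1z -gtz0_ge1.
rewrite cf_convergentS -[leLHS]addr0 lerD //; first by rewrite ler1z -gtz0_ge1.
by rewrite invr_ge0 (le_trans ler01) // ih.
Qed.

(* Each level of the continued fraction divides distances by c v, where the
   convergent c of a reduced irrational is >= 1 and its value v is >= 1 / r. *)
Lemma cf_convergent_dist (n : nat) (x : nat * nat) : reduced x ->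
  `|cf_convergent R (fun i => (quot (iter i cf_step x))%:Z) n - cf_value x|
    <= r ^+ n.
Proof.
have /andP[r0 r1] := ratio_bounds.
elim: n x => [|n ih] x rx; have ry := cf_step_reduced _ rx.
  rewrite /= (cf_value_step _ rx) expr0 opprD addNKr normrN.
  have v_gt0 : 0 < cf_value (cf_step x).
    by apply: lt_le_trans (cf_value_ge _ ry); rewrite invr_gt0.
  rewrite gtr0_norm ?invr_gt0 // invf_le1 // (le_trans _ (cf_value_ge _ ry)) //.
  by rewrite invf_ge1 // ltW.
rewrite cf_convergentS (cf_value_step _ rx) /=.
have -> : (fun i => (quot (cf_step (iter i cf_step x)))%:Z)
    = (fun i => (quot (iter i cf_step (cf_step x)))%:Z).
  by apply/funext => i; rewrite -iterS iterSr.
set c := cf_convergent _ _ _; set v := cf_value _.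
have c1 : 1 <= c.
  apply: cf_convergent_ge1 => i.
  have := iter_reduced i _ ry; case: (iter _ _ _) => P Q /quotP[+ _ _ _].
  by rewrite ltz_nat.
have v1 : r^-1 <= v by apply: cf_value_ge.
have ihx : `|c - v| <= r ^+ n := ih _ ry.
clearbody c v.
have v0 : 0 < v by apply: lt_le_trans v1; rewrite invr_gt0.
have c0 : 0 < c by apply: lt_le_trans c1.
have -> : (quot x)%:R + c^-1 - ((quot x)%:R + v^-1) = (v - c) / (c * v).
  by field; rewrite !gt_eqF.
rewrite normrM normfV [X in _ / X]gtr0_norm ?mulr_gt0 // distrC.
rewrite ler_pdivrMr ?mulr_gt0 // (le_trans ihx) // exprSr -mulrA.
rewrite ler_peMr ?exprn_ge0 ?(ltW r0) // -ler_pdivrMl // mulr1 (le_trans v1) //.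
by rewrite ler_peMl // ltW.
Qed.

Lemma cf_quot_expansion : is_cf_expansion w cf_quot.
Proof.
split.
  case=> // n _; have := iter_cf_step_reduced n.+1; rewrite /cf_quot.
  by case: (iter _ _ _) => P Q /quotP[+ _ _ _]; rewrite ltz_nat.
have /andP[r0 r1] := ratio_bounds.
apply: (cvg_geometric_bound _ _ r); first by rewrite ltW.
move=> n; have := cf_convergent_dist n _ start_reduced.
(* The two quotient sequences differ only at index 0, by [s]. *)
suff -> : cf_convergent R cf_quot n = cf_convergent R
    (fun i => (quot (iter i cf_step start))%:Z) n - s%:R.
  by rewrite /cf_value divr1 opprD addrA.
by case: n => [|n] /=; rewrite quot_start -!pmulrn natrM; ring.
Qed.

Lemma cf_period_length_sqrt : cf_period_length w cf_period.
Proof.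
by exists cf_quot; split; [exact: cf_quot_expansion|exact: cf_quot_min_period].
Qed.

End Value.

End SqrtContinuedFraction.

(** * Squares and norms modulo 8 and 16 *)

Lemma sum_squares_mod8 (P Q : nat) :
  ((P ^ 2 + Q ^ 2) %% 8)%N \notin [:: 3; 6; 7]%N.
Proof.
have chk : all (fun u => all (fun v =>
    ((u ^ 2 + v ^ 2) %% 8)%N \notin [:: 3; 6; 7]%N) (iota 0 8)) (iota 0 8) by [].
rewrite -modnDm -modnXm -(modnXm _ _ Q) modnDm.
have r8 k : (k %% 8)%N \in iota 0 8 by rewrite mem_iota add0n ltn_mod.
exact: (allP (allP chk _ (r8 P)) _ (r8 Q)).
Qed.

Lemma norm_mod16 (N : nat) (x y : int) :
  (x ^+ 2 - N%:Z * y ^+ 2 = 2 -> (N %% 16)%N \notin [:: 3; 11; 6]%N) /\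
  (x ^+ 2 - N%:Z * y ^+ 2 = - 2 -> (N %% 16)%N \notin [:: 7; 15; 14]%N).
Proof.
(* All residues are tried, with terms moved across to avoid subtraction; the added 0 gives both
   cases the shape of [red]. *)
have chk : all (fun n => all (fun u => all (fun v =>
    ((u ^ 2 + 0 == n * v ^ 2 + 2 %[mod 16]) ==> (n \notin [:: 3; 11; 6])) &&
    ((u ^ 2 + 2 == n * v ^ 2 + 0 %[mod 16]) ==> (n \notin [:: 7; 15; 14])))%N
  (iota 0 16)) (iota 0 16)) (iota 0 16) by vm_compute.
have r16 k : (k %% 16)%N \in iota 0 16 by rewrite mem_iota add0n ltn_mod.
have sqE (z : int) : z ^+ 2 = (`|z| ^ 2)%N%:Z by lia.
rewrite !sqE; move: `|x|%N `|y|%N => {}x {}y.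
have /andP[/implyP c1 /implyP c2] :=
  allP (allP (allP chk _ (r16 N)) _ (r16 x)) _ (r16 y).
have red (u v : nat) : (x ^ 2 + u = N * y ^ 2 + v)%N ->
    ((x %% 16) ^ 2 + u == (N %% 16) * (y %% 16) ^ 2 + v %[mod 16])%N.
  move=> E; rewrite -modnDml modnXm modnDml E -[X in _ == X]modnDml.
  by rewrite modnMml -[in X in _ == X]modnMmr modnXm modnMmr modnDml.
by split=> E; [apply/c1/red|apply/c2/red]; lia.
Qed.

(** * The period length modulo 4 *)

Lemma nat_sqrt_exists (N : nat) : exists s : nat, (s ^ 2 <= N < s.+1 ^ 2)%N.
Proof.
elim: N => [|N [s /andP[s1 s2]]]; first by exists 0%N.
have [h|h] := ltnP N.+1 (s.+1 ^ 2); first by exists s; lia.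
by exists s.+1; lia.
Qed.

(* The hypothesis on Q says that the only nontrivial fixed point of flipP in the
   period has denominator 2; the sign of the norm 2 is then forced mod 16. *)
Lemma cf_period_length_mod4 (R : realType) (N : nat) :
  (N %% 8)%N \in [:: 3; 6; 7]%N ->
  (forall P Q : nat, (0 < P)%N -> (P ^ 2 < N)%N -> (1 < Q)%N -> (Q %| 2 * P)%N ->
     (Q %| N - P ^ 2)%N -> Q = 2%N) ->
  exists l : nat, cf_period_length (Num.sqrt (N%:R : R)) l /\
    l = (if (N %% 16)%N \in [:: 3; 11; 6]%N then 2 else 0)%N %[mod 4].
Proof.
move=> N8 Q2; have [s /andP[sN Ns]] := nat_sqrt_exists N.
have {}sN : (s ^ 2 < N)%N.
  rewrite ltn_neqAle sN andbT; apply: contraTneq N8 => <-.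
  by rewrite -[(s ^ 2)%N]addn0 (sum_squares_mod8 s 0).
exists (cf_period N s sN Ns); split; first exact: cf_period_length_sqrt.
move: (odd_double_half (cf_period N s sN Ns)) => /esym.
case: (odd _) => mE; last first.
  move: (half _) mE => m mE.
  have [P [Q [x [y [/andP[P0 Ps] Q1 QP QN xy]]]]] :=
    cf_period_even_norm _ _ _ _ _ mE.
  have PN : (P ^ 2 < N)%N by apply: (leq_ltn_trans _ sN); rewrite leq_exp2r.
  have QE : Q = 2%N := Q2 _ _ P0 PN Q1 QP QN.
  rewrite mE; rewrite QE in xy; have [pos neg] := norm_mod16 N x y.
  have := odd_double_half m; move: N8; rewrite !inE => N8.
  (* Odd [m] gives norm -2, leaving 3, 11, 6 for [N] mod 16; even [m] gives norm 2, leaving 7, 15,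
     14. *)
  rewrite -signr_odd in xy; case: (odd m) xy => xy mm.
    have := neg xy; rewrite !inE => N16.
    by case: ifP => N16'; clear -N8 N16 N16' mm; lia.
  have := pos xy; rewrite !inE => N16.
  by case: ifP => N16'; clear -N8 N16 N16' mm; lia.
have [P [Q NE]] := cf_period_odd_sum_squares _ _ _ _ _ mE.
by have := sum_squares_mod8 P Q; rewrite -NE N8.
Qed.

(** * The central denominator for [p] and [2 p] *)

(** If [p] divided [P], then [P^2 >= p^2 >= 2 p]. This keeps [p] out of any [Q] dividing [2 P]. *)
Lemma sqr_lt_not_dvdn (p P : nat) : prime p -> (2 < p)%N -> (0 < P)%N ->
  (P ^ 2 < 2 * p)%N -> ~~ (p %| 2 * P)%N.
Proof.
move=> pp p2 P0 Pp; rewrite Euclid_dvdM // negb_or gtnNdvd //=.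
apply: contraL Pp => /(dvdn_leq P0) pP; rewrite -leqNgt -mulnn.
by rewrite leq_mul // ltnW // (leq_trans p2).
Qed.

Lemma dvdn_4_mul_prime (p Q : nat) : prime p -> (Q %| 4 * p)%N -> ~~ (p %| Q)%N ->
  Q \in [:: 1; 2; 4]%N.
Proof.
move=> pp Qp pQ.
have : (Q %| 4)%N.
  by rewrite -(@Gauss_dvdl Q 4 p) // coprime_sym prime_coprime.
by case: Q {Qp pQ} => [|[|[|[|[|Q]]]]] // /dvdn_leq => /(_ isT).
Qed.

Lemma central_denominator (p N P Q : nat) : prime p -> p = 3 %[mod 4] ->
  N = p \/ N = (2 * p)%N -> (0 < P)%N -> (P ^ 2 < N)%N -> (1 < Q)%N ->
  (Q %| 2 * P)%N -> (Q %| N - P ^ 2)%N -> Q = 2%N.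
Proof.
move=> pp p4 Np P0 PN Q1 QP QN.
have p2 : (2 < p)%N by case: p pp p4 {Np} => [|[|[|]]].
have Q2N : (Q %| 2 * N)%N.
  have -> : (2 * N = 2 * (N - P ^ 2) + 2 * P * P)%N by nia.
  by apply: dvdn_add; [exact: dvdn_mull | exact: dvdn_mulr].
have pQ : ~~ (p %| Q)%N.
  apply/negP => /dvdn_trans/(_ QP); apply/negP/sqr_lt_not_dvdn => //.
  by apply: leq_trans PN _; lia.
have : Q \in [:: 1; 2; 4]%N.
  apply: (dvdn_4_mul_prime p) => //; apply: dvdn_trans Q2N _.
  by case: Np => ->; rewrite ?mulnA // dvdn_mul.
rewrite !inE => /or3P[/eqP Q1'|/eqP//|/eqP Q4]; first by rewrite Q1' in Q1.
(* [Q = 4] makes [P] even, hence [4 | N], impossible for [p] or [2 p] with [p] odd. *)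
rewrite Q4 in QP QN Q2N; exfalso.
case/dvdnP: QP => k kE; have PE : P = (k * 2)%N by lia.
case/dvdnP: QN => j jE.
by case: Np => NE; rewrite PE NE in PN jE; nia.
Qed.

Theorem corollary3p7 (R : realType) (p : nat)
    (p_prime : prime p) (p_mod4 : p = 3 %[mod 4]) :
  exists lp l2p : nat,
    [/\ cf_period_length (Num.sqrt (p%:R : R)) lp,
        cf_period_length (Num.sqrt ((2 * p)%:R : R)) l2p,
        p = 3 %[mod 8] -> lp = l2p %[mod 4] /\ l2p = 2 %[mod 4]
      & p = 7 %[mod 8] -> lp = l2p %[mod 4] /\ l2p = 0 %[mod 4]].
Proof.
have [|P Q|lp [Hp lpE]] := cf_period_length_mod4 R p.
- by rewrite !inE; lia.
- exact: central_denominator p_prime p_mod4 (or_introl erefl).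
have [|P Q|l2p [H2p l2pE]] := cf_period_length_mod4 R (2 * p).
- by rewrite !inE; lia.
- exact: central_denominator p_prime p_mod4 (or_intror erefl).
(* Modulo 16, [p] is 3 or 11 and [2 p] is 6 in the first case; [p] is 7 or 15 and [2 p] is 14 in the
   second. *)
exists lp, l2p; split=> // p8; move: lpE l2pE; rewrite !inE.
  by do 2![case: ifP]; lia.
by do 2![case: ifP]; lia.
Qed.
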